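(* Let $\gamma$ be a convex piecewise affine function on a star $\omega\subset\mathbb{R}^d$ ($d\ge2$) centered at the origin. Then there is a constant $C=C(d)$ such that $$|\nabla\gamma(0)|\le C\Big(\sum_{F\in\mathcal{F}(0)}J_F(\gamma)\Big)^d ,$$ where $|\nabla\gamma(0)|$ is the $d$-dimensional Lebesgue measure of the sub-differential of $\gamma$ at $0$ and $\mathcal{F}(0)$ is the set of $(d-1)$-dimensional simplices (faces) of $\omega$ containing the origin.
   Context: A star $\omega$ centered at the origin is a finite union of $d$-simplices forming a conforming simplicial partition of $\omega$, each having $0$ as a vertex, with $0$ in the interior of $\omega$. Piecewise affine means continuous and affine on each of these simplices; convex means being the restriction to $\omega$ of a convex function; the normalization $\gamma(0)=0$ is in force. The sub-differential at the origin is the set $\nabla\gamma(0)=\{w\in\mathbb{R}^d:\langle w,x\rangle+\gamma(0)\le\gamma(x)\ \forall x\in\omega\}$. For a face $F\in\mathcal{F}(0)$ shared by elements $K^+,K^-$ with outer unit normals $n_F^\pm$ of $K^\pm$ on $F$, the jump is $J_F(\gamma)=-n_F^+\cdot\nabla\gamma|_{K^+}-n_F^-\cdot\nabla\gamma|_{K^-}$. *)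

(* Defs.v *)
From HB Require Import structures.
From mathcomp Require Import all_boot all_order all_algebra finmap.
From mathcomp Require Import all_classical all_reals all_analysis.

Set Implicit Arguments.
Unset Strict Implicit.
Unset Printing Implicit Defensive.

Import Order.TTheory GRing.Theory Num.Theory.
Import numFieldNormedType.Exports.

Local Open Scope classical_set_scope.
Local Open Scope ring_scope.

(* The norm that the library puts on 'rV[R]_d is the max norm. It induces the
   usual topology, but unit vectors and gradients are taken with respect to
   this inner product. *)
Definition dot (R : realType) (d : nat) (u v : 'rV[R]_d) : R :=
  \sum_(i < d) u ord0 i * v ord0 i.

Section LebesgueMeasure.
Context (R : realType) (d : nat).

Definition box (a b : 'rV[R]_d) : set 'rV[R]_d :=
  [set x | forall i, a ord0 i <= x ord0 i <= b ord0 i].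

Definition box_volume (a b : 'rV[R]_d) : R :=
  \prod_(i < d) (b ord0 i - a ord0 i).

Definition box_cover (A : set 'rV[R]_d) (ab : nat -> 'rV[R]_d * 'rV[R]_d) :=
  (forall k i, (ab k).1 ord0 i <= (ab k).2 ord0 i) /\
  A `<=` \bigcup_k box (ab k).1 (ab k).2.

(* Lebesgue outer measure on R^d. It extends the d-dimensional Lebesgue
   measure, hence agrees with it on every Lebesgue measurable set; in
   particular on sub-differentials, which are closed. *)
Definition lebesgue_rV (A : set 'rV[R]_d) : \bar R :=
  ereal_inf [set (\sum_(0 <= k <oo) (box_volume (ab k).1 (ab k).2)%:E)%E
            | ab in box_cover A].

End LebesgueMeasure.

Section Simplices.
Context (R : realType) (d : nat).

(* Simplices are represented by their finite sets of vertices, and conforming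
   simplicial partitions by finite sets of those. *)
Implicit Types (S F K : {fset 'rV[R]_d}) (T : {fset {fset 'rV[R]_d}}).

Definition hull S : set 'rV[R]_d :=
  [set x | exists a : 'rV[R]_d -> R,
    [/\ forall p, p \in S -> 0 <= a p,
        \sum_(p <- S) a p = 1 &
        x = \sum_(p <- S) a p *: p]].

Definition affinely_independent S : Prop :=
  forall a : 'rV[R]_d -> R,
    \sum_(p <- S) a p = 0 -> \sum_(p <- S) a p *: p = 0 ->
    forall p, p \in S -> a p = 0.

Definition is_simplex (k : nat) S : Prop :=
  #|` S|%fset = k.+1 /\ affinely_independent S.

Definition star_domain T : set 'rV[R]_d :=
  [set x | exists2 K, K \in T & hull K x].

(* Two elements intersect exactly in the simplex spanned by their common
   vertices; for distinct elements this is a common proper face, so that the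
   elements do not overlap. *)
Definition conforming T : Prop :=
  forall K K', K \in T -> K' \in T ->
    hull K `&` hull K' = hull (K `&` K')%fset.

Definition is_star T : Prop :=
  [/\ forall K, K \in T -> is_simplex d K /\ 0 \in K,
      conforming T &
      interior (star_domain T) 0].

(* A (d-1)-dimensional face has d vertices. As 0 is a vertex of every element
   of a star, a face contains the origin iff 0 is one of its vertices. *)
Definition faces0 T : {fset {fset 'rV[R]_d}} :=
  [fset F in (\bigcup_(K <- T) fpowerset K)%fset
  | (#|` F|%fset == d) && (0 \in F)]%fset.

Definition is_outer_unit_normal K F (n : 'rV[R]_d) : Prop :=
  [/\ dot n n = 1,
      forall x y, hull F x -> hull F y -> dot n (x - y) = 0 &
      forall x y, hull K x -> hull F y -> dot n (x - y) <= 0].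

(* Unique if F is a (d-1)-dimensional face of the d-simplex K. *)
Definition outer_unit_normal K F : 'rV[R]_d :=
  xget 0 [set n | is_outer_unit_normal K F n].

End Simplices.

Section PiecewiseAffine.
Context (R : realType) (d : nat).
Implicit Types (F K : {fset 'rV[R]_d}) (T : {fset {fset 'rV[R]_d}}).
Implicit Types gamma : 'rV[R]_d -> R.

Definition affine_with_gradient gamma (A : set 'rV[R]_d) (g : 'rV[R]_d) : Prop :=
  exists c : R, forall x, A x -> gamma x = dot g x + c.

Definition piecewise_affine T gamma : Prop :=
  {within star_domain T, continuous gamma} /\
  forall K, K \in T -> exists g, affine_with_gradient gamma (hull K) g.

(* Only the values of gamma on omega are relevant. *)
Definition convex_on_star (omega : set 'rV[R]_d) gamma : Prop :=
  exists2 g : 'rV[R]_d -> R,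
    convex_function [set: 'rV[R]_d] g & {in omega, gamma =1 g}.

(* Unique if K is a d-simplex on which gamma is affine. *)
Definition grad gamma K : 'rV[R]_d :=
  xget 0 [set g | affine_with_gradient gamma (hull K) g].

(* The sum runs over the elements sharing F. In a star, a face F containing
   the interior point 0 is shared by exactly two; see jumpE. *)
Definition jump T gamma F : R :=
  \sum_(K <- T | (F `<=` K)%fset) - dot (outer_unit_normal K F) (grad gamma K).

Lemma jumpE T gamma F Kp Km :
  Kp != Km ->
  (forall K, (K \in T) && (F `<=` K)%fset = (K == Kp) || (K == Km)) ->
  jump T gamma F = - dot (outer_unit_normal Kp F) (grad gamma Kp)
                   - dot (outer_unit_normal Km F) (grad gamma Km).
Proof.
move=> neK eT; rewrite /jump -big_filter (perm_big [:: Kp; Km]) /=.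
  by rewrite big_cons big_seq1.
apply: uniq_perm; rewrite ?filter_uniq ?fset_uniq //= ?inE ?neK // => K.
by rewrite mem_filter andbC eT !inE.
Qed.

Definition subdifferential0 (omega : set 'rV[R]_d) gamma : set 'rV[R]_d :=
  [set w | forall x, omega x -> dot w x + gamma 0 <= gamma x].

End PiecewiseAffine.

(* Main.v *)
Require Import Defs.
From mathcomp Require Import all_boot all_order all_algebra finmap.
From mathcomp Require Import all_classical all_reals all_analysis.
From mathcomp Require Import ring lra.

Set Implicit Arguments.
Unset Strict Implicit.
Unset Printing Implicit Defensive.

Import Order.TTheory GRing.Theory Num.Theory.
Import numFieldNormedType.Exports.

Local Open Scope classical_set_scope.
Local Open Scope ring_scope.

(* Let [g_K] be the gradient on [K]. Convexity makes the positively homogeneous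
   extension of [gamma] equal to [max_K g_K], so the sub-differential lies in the
   box whose [i]-th side is [(g_K - g_K') . e_i], where [e_i] is in the cone of
   [K] and [- e_i] in that of [K']. A generic line between interior points of two
   cones meets no two facet hyperplanes of an element at once, so [K] and [K']
   are joined by a chain of pairwise distinct elements sharing facets. Each
   facet is in exactly two elements, so the facets of the chain are distinct; the
   gradient changes across a facet [F] by a vector of Euclidean norm [J_F >= 0].
   So every side is at most the sum of the jumps, and [C = 1] works. *)

(** * Euclidean inner product *)

Section InnerProduct.
Context (R : realType) (d : nat).
Implicit Types u v w x : 'rV[R]_d.

Lemma dotC u v : dot u v = dot v u.
Proof. by apply: eq_bigr => i _; rewrite mulrC. Qed.

Lemma dotDr u v w : dot u (v + w) = dot u v + dot u w.
Proof. by rewrite -big_split; apply: eq_bigr => i _; rewrite mxE mulrDr. Qed.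

Lemma dotZr u a v : dot u (a *: v) = a * dot u v.
Proof. by rewrite mulr_sumr; apply: eq_bigr => i _; rewrite mxE mulrCA. Qed.

Lemma dot0r u : dot u 0 = 0.
Proof. by rewrite -(scale0r 0) dotZr mul0r. Qed.

Lemma dotNr u v : dot u (- v) = - dot u v.
Proof. by rewrite -scaleN1r dotZr mulN1r. Qed.

Lemma dotBr u v w : dot u (v - w) = dot u v - dot u w.
Proof. by rewrite dotDr dotNr. Qed.

Lemma dotZl u a v : dot (a *: u) v = a * dot u v.
Proof. by rewrite dotC dotZr dotC. Qed.

Lemma dotBl u v w : dot (u - v) w = dot u w - dot v w.
Proof. by rewrite dotC dotBr !(dotC w). Qed.

Lemma dot0l u : dot 0 u = 0.
Proof. by rewrite dotC dot0r. Qed.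

Lemma dot_sumr u (I : Type) (s : seq I) (P : pred I) (f : I -> 'rV[R]_d) :
  dot u (\sum_(i <- s | P i) f i) = \sum_(i <- s | P i) dot u (f i).
Proof. exact: (big_morph _ (dotDr u) (dot0r u)). Qed.

Lemma dot_delta u i : dot u (delta_mx 0 i) = u 0 i.
Proof.
rewrite /dot (bigD1 i) //= mxE !eqxx mulr1 big1 ?addr0 // => j ji.
by rewrite mxE eqxx (negbTE ji) mulr0.
Qed.

Lemma dot_inj u v : (forall x, dot u x = dot v x) -> u = v.
Proof.
by move=> uv; apply/rowP => i; rewrite -!dot_delta uv.
Qed.

Lemma sqr_coord_le_dot u i : u 0 i ^+ 2 <= dot u u.
Proof.
by rewrite /dot (bigD1 i) //= -expr2 lerDl sumr_ge0 // => j _; rewrite -expr2 sqr_ge0.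
Qed.

Lemma dot_gt0 u : u != 0 -> 0 < dot u u.
Proof.
move=> u0; have [i ui] : exists i, u 0 i != 0.
  apply/existsP; apply: contraR u0; rewrite negb_exists => /forallP u0.
  by apply/eqP/rowP => i; rewrite mxE; apply/eqP; have := u0 i; rewrite negbK.
by apply: lt_le_trans (sqr_coord_le_dot u i); rewrite exprn_even_gt0.
Qed.

End InnerProduct.

(** The least of finitely many thresholds serves all, since each condition holds on a whole interval
    []0, e]]. It lets a point move a little with finitely many linear forms under control. *)
Lemma uniform_threshold (R : realFieldType) (I : eqType) (s : seq I)
    (P : I -> R -> Prop) :
  (forall i, i \in s -> exists2 e, 0 < e & forall t, 0 < t <= e -> P i t) ->
  exists2 e, 0 < e & forall i, i \in s -> forall t, 0 < t <= e -> P i t.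
Proof.
elim: s => [|i s IH] H; first by exists 1.
have [e1 e10 h1] := H i (mem_head _ _).
have [j js|e2 e20 h2] := IH; first by apply: H; rewrite inE js orbT.
exists (Num.min e1 e2) => [|j]; first by rewrite lt_min e10.
rewrite inE => /predU1P[->|js] t /andP[t0]; rewrite le_min => /andP[t1 t2].
  by apply: h1; rewrite t0.
by apply: h2; rewrite ?t0.
Qed.

(** * Coordinates and cone of a simplex with vertex 0 *)

Section DualBasis.
Context (R : realType) (d : nat).
Implicit Types (K : {fset 'rV[R]_d}) (p q x : 'rV[R]_d).

Definition vertex_mx K : 'M[R]_d := \matrix_(i < d) nth 0 (K `\ 0)%fset i.

(** The column of the inverse vertex matrix at the index of [p], so that [dot (dual K p) x] is the
    coordinate of [x] along [p]. Summing over matching indices avoids a proof that the index is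
    below [d], and gives 0 if it is not. *)
Definition dual K p : 'rV[R]_d :=
  \row_j \sum_(k < d | k == index p (K `\ 0)%fset :> nat)
    invmx (vertex_mx K) j k.

(** For a simplex with vertex 0 this is the cone spanned by the vertices, described by its facet
    inequalities. *)
Definition cone K : set 'rV[R]_d :=
  [set x | forall p, p \in (K `\ 0)%fset -> 0 <= dot (dual K p) x].

Definition simplex0 K : Prop := is_simplex d K /\ 0 \in K.

Lemma size_simplex0 K : simplex0 K -> size (K `\ 0)%fset = d.
Proof.
move=> [[cK _] K0]; have := cardfsD1 0 K; rewrite cK K0 /= add1n.
by move/eqP; rewrite eqSS => /eqP/esym.
Qed.

Lemma sum_vertex_mx K (f : 'rV[R]_d -> R) : simplex0 K ->
  \sum_(p <- (K `\ 0)%fset) f p *: p =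
  (\row_i f (nth 0 (K `\ 0)%fset i)) *m vertex_mx K.
Proof.
move=> sK; rewrite mulmx_sum_row (big_nth 0) size_simplex0 // big_mkord.
by apply: eq_bigr => i _; rewrite mxE rowK.
Qed.

(** A linear relation between the nonzero vertices becomes an affine relation between all vertices
    once the vertex 0 receives minus the sum of the coefficients; affine independence then makes it
    trivial. *)
Lemma vertex_mx_unit K : simplex0 K -> vertex_mx K \in unitmx.
Proof.
move=> sK; rewrite -row_free_unit; apply: inj_row_free => v v0.
pose B := (K `\ 0)%fset.
have sB : size B = d := size_simplex0 sK.
pose f p : R := \sum_(k < d | k == index p B :> nat) v 0 k.
have fn (i : 'I_d) : f (nth 0 B i) = v 0 i.
  rewrite /f index_uniq ?fset_uniq ?sB //.
  by rewrite (eq_bigl (pred1 i)) ?big_pred1_eq // => k; rewrite /= val_eqE.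
have vE : v = \row_i f (nth 0 B i) by apply/rowP => i; rewrite mxE fn.
have [[_ aK] K0] := sK.
pose a p := if p == 0 then - \sum_(q <- B) f q else f p.
have aE : \sum_(p <- B) a p = \sum_(p <- B) f p.
  rewrite [LHS]big_seq [RHS]big_seq; apply: eq_bigr => p.
  by rewrite /a in_fsetD1 => /andP[/negPf ->].
have aE' : \sum_(p <- B) a p *: p = \sum_(p <- B) f p *: p.
  rewrite [LHS]big_seq [RHS]big_seq; apply: eq_bigr => p.
  by rewrite /a in_fsetD1 => /andP[/negPf ->].
have h : forall p, p \in K -> a p = 0.
  apply: aK.
    by rewrite (big_fsetD1 0) //= aE /a eqxx addNr.
  by rewrite (big_fsetD1 0) //= aE' scaler0 add0r sum_vertex_mx // -vE.
apply/rowP => i; rewrite mxE -fn.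
have iB : nth 0 B i \in B by rewrite mem_nth ?sB.
have := iB; rewrite in_fsetD1 => /andP[/negPf n0 iK].
by have := h _ iK; rewrite /a n0.
Qed.

Lemma dual_expand K x : simplex0 K ->
  x = \sum_(p <- (K `\ 0)%fset) dot (dual K p) x *: p.
Proof.
move=> sK; rewrite (sum_vertex_mx (fun p => dot (dual K p) x)) //.
suff -> : \row_i dot (dual K (nth 0 (K `\ 0)%fset i)) x = x *m invmx (vertex_mx K).
  by rewrite mulmxKV // vertex_mx_unit.
apply/rowP => i; rewrite !mxE; apply: eq_bigr => j _.
rewrite !mxE mulrC index_uniq ?fset_uniq ?size_simplex0 //.
by rewrite (eq_bigl (pred1 i)) ?big_pred1_eq // => k; rewrite /= val_eqE.
Qed.

Lemma dual_dot K p q : simplex0 K -> p \in (K `\ 0)%fset -> q \in (K `\ 0)%fset ->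
  dot (dual K p) q = (p == q)%:R.
Proof.
move=> sK pB qB; have sB := size_simplex0 sK.
have ip : (index p (K `\ 0%R)%fset < d)%N by rewrite -[ltnRHS]sB index_mem.
have iq : (index q (K `\ 0%R)%fset < d)%N by rewrite -[ltnRHS]sB index_mem.
have := mulmxV (vertex_mx_unit sK).
move=> /matrixP /(_ (Ordinal iq) (Ordinal ip)); rewrite !mxE => e.
transitivity ((Ordinal iq == Ordinal ip)%:R : R); last first.
  rewrite -val_eqE /= eq_sym; congr (_%:R); congr nat_of_bool.
  by apply/eqP/eqP => [/index_inj->|->].
rewrite -e; apply: eq_bigr => j _; rewrite !mxE mulrC nth_index //.
by congr (_ * _); rewrite (eq_bigl (pred1 (Ordinal ip))) ?big_pred1_eq // => k;
  rewrite /= -val_eqE.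
Qed.

Lemma dot_inj_vertices K u v : simplex0 K ->
  (forall p, p \in (K `\ 0)%fset -> dot u p = dot v p) -> u = v.
Proof.
move=> sK uv; apply: dot_inj => x; rewrite (dual_expand x sK) !dot_sumr.
rewrite [LHS]big_seq [RHS]big_seq; apply: eq_bigr => p pB.
by rewrite !dotZr uv.
Qed.

Lemma dual_comb K p (f : 'rV[R]_d -> R) : simplex0 K -> p \in (K `\ 0)%fset ->
  dot (dual K p) (\sum_(q <- (K `\ 0)%fset) f q *: q) = f p.
Proof.
move=> sK pB; rewrite dot_sumr (big_fsetD1 p) //= dotZr dual_dot // eqxx mulr1.
rewrite big_seq big1 ?addr0 // => q; rewrite in_fsetD1 => /andP[qp qB].
by rewrite dotZr dual_dot // eq_sym (negPf qp) mulr0.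
Qed.

Lemma coneZV K x t : 0 < t -> cone K (t *: x) -> cone K x.
Proof.
by move=> t0 Kx p pB; have := Kx p pB; rewrite dotZr pmulr_rge0.
Qed.

Lemma cone_vertex K p : simplex0 K -> p \in K -> cone K p.
Proof.
move=> sK pK q qB; have [->|p0] := eqVneq p 0; first by rewrite dot0r.
by rewrite dual_dot ?ler0n // in_fsetD1 p0.
Qed.

(** The vertex 0 contributes to no coordinate, so [S] may or may not contain it. *)
Lemma hull_comb K S (f : 'rV[R]_d -> R) :
  simplex0 K -> (S `<=` K)%fset ->
  forall p, p \in (K `\ 0)%fset ->
  dot (dual K p) (\sum_(q <- S) f q *: q) = if p \in S then f p else 0.
Proof.
move=> sK SK p pB; have p0 : p != 0 by move: pB; rewrite in_fsetD1 => /andP[].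
have dE q : q \in S -> q != p -> dot (dual K p) (f q *: q) = 0.
  move=> qS qp; rewrite dotZr; have [->|q0] := eqVneq q 0.
    by rewrite dot0r mulr0.
  have qB : q \in (K `\ 0)%fset by rewrite in_fsetD1 q0 (fsubsetP SK).
  by rewrite dual_dot // eq_sym (negPf qp) mulr0.
rewrite dot_sumr; case: ifPn => pS.
  rewrite (big_fsetD1 p) //= dotZr dual_dot // eqxx mulr1.
  rewrite big_seq big1 ?addr0 // => q; rewrite in_fsetD1 => /andP[qp qS].
  exact: dE.
rewrite big_seq big1 // => q qS; apply: dE => //.
by apply: contraNneq pS => <-.
Qed.

Lemma hull_cone K x : simplex0 K -> hull K x -> cone K x.
Proof.
move=> sK [a [a0 _ ->]] p pB; rewrite hull_comb //.
by case: ifP => // pK; apply: a0.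
Qed.

Lemma hull_vertex K p : p \in K -> hull K p.
Proof.
move=> pK; exists (fun q => (q == p)%:R); split.
- by move=> q _; apply: ler0n.
- rewrite (big_fsetD1 p) //= eqxx big_seq big1 ?addr0 // => q.
  by rewrite in_fsetD1 => /andP[/negPf->].
- rewrite (big_fsetD1 p) //= eqxx scale1r big_seq big1 ?addr0 // => q.
  by rewrite in_fsetD1 => /andP[/negPf-> _]; rewrite scale0r.
Qed.

Lemma cone_hull K x : simplex0 K -> cone K x ->
  exists2 e, 0 < e & forall t, 0 < t <= e -> hull K (t *: x).
Proof.
move=> sK Kx; pose l p := dot (dual K p) x.
pose s := \sum_(p <- (K `\ 0)%fset) l p.
have s0 : 0 <= s by rewrite /s big_seq; apply: sumr_ge0 => p pB; apply: Kx.
have [_ K0] := sK.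
have s1 : 0 < 1 + s by rewrite ltr_pwDl.
(* The nonzero vertices then carry total weight [t * s <= 1], and the vertex 0 takes the rest.
   Adding 1 covers [s = 0]. *)
exists (1 + s)^-1 => [|t /andP[t0 t1]]; first by rewrite invr_gt0.
have ts : t * s <= 1.
  have : t * (1 + s) <= 1 by rewrite -ler_pdivlMr // mul1r.
  by apply: le_trans; rewrite ler_pM2l // lerDr.
exists (fun p => if p == 0 then 1 - t * s else t * l p); split.
- move=> p pK; case: ifPn => p0; first by rewrite subr_ge0.
  by rewrite mulr_ge0 ?(ltW t0) // Kx // in_fsetD1 p0.
- rewrite (big_fsetD1 0) //= eqxx.
  under eq_big_seq => p.
    rewrite in_fsetD1 => /andP[/negPf -> _]; over.
  by rewrite -mulr_sumr subrK.
- rewrite (big_fsetD1 0) //= scaler0 add0r {1}(dual_expand x sK) scaler_sumr.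
  apply: eq_big_seq => p; rewrite in_fsetD1 => /andP[/negPf -> _].
  by rewrite scalerA.
Qed.

End DualBasis.

(** * The cones of a star: covering and intersections *)

Section StarGeometry.
Context (R : realType) (d : nat) (T : {fset {fset 'rV[R]_d}}).
Hypothesis starT : is_star T.
Implicit Types (F K : {fset 'rV[R]_d}) (p q x : 'rV[R]_d).

Definition in_cone_interior K x : Prop :=
  forall p, p \in (K `\ 0)%fset -> 0 < dot (dual K p) x.

Lemma star_simplex0 K : K \in T -> simplex0 K.
Proof. by case: starT => h _ _ /h. Qed.

Lemma cone_interior_cone K x : in_cone_interior K x -> cone K x.
Proof. by move=> Kx p pB; apply/ltW/Kx. Qed.

Lemma cone_interior_exists K : K \in T -> exists x, in_cone_interior K x.
Proof.
move=> KT; exists (\sum_(q <- (K `\ 0)%fset) 1 *: q) => p pB.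
by rewrite (dual_comb (fun=> 1)) //; apply: star_simplex0.
Qed.

Lemma cone_cover x : exists2 K, K \in T & cone K x.
Proof.
have [_ _ /nbhs_ballP [e /= e0 eT]] := starT.
(* Brings [t *: x] into the ball of radius [e], also for [x = 0]. *)
pose t := e / (2 * (1 + `|x|)).
have x1 : 0 < 1 + `|x| by rewrite ltr_pwDl.
have t0 : 0 < t by rewrite divr_gt0 // mulr_gt0.
have [K KT Kx] : star_domain T (t *: x).
  apply: eT; rewrite -ball_normE /= sub0r normrN normrZ gtr0_norm //.
  rewrite /t mulrAC ltr_pdivrMr ?mulr_gt0 // ltr_pM2l //.
  by have := normr_ge0 x; lra.
by exists K => //; apply: coneZV t0 _; apply: hull_cone Kx; apply: star_simplex0.
Qed.

(** Scaled into both simplices, the point lies in the hull of their common vertices, where every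
    other vertex has coordinate 0. *)
Lemma conforming_dual K K' x p : K \in T -> K' \in T -> cone K x -> cone K' x ->
  p \in (K `\ 0)%fset -> p \notin K' -> dot (dual K p) x = 0.
Proof.
move=> KT K'T Kx K'x pB pK'.
have sK := star_simplex0 KT; have sK' := star_simplex0 K'T.
have [e e0 he] := cone_hull sK Kx; have [e' e'0 he'] := cone_hull sK' K'x.
pose t := Num.min e e'.
have t0 : 0 < t by rewrite lt_min e0.
have : (hull K `&` hull K') (t *: x).
  by split; [apply: he|apply: he']; rewrite t0 ge_min lexx ?orbT.
have [_ conf _] := starT; rewrite conf // => -[a [_ _ ax]].
apply: (mulfI (lt0r_neq0 t0)); rewrite mulr0 -dotZr ax.
by rewrite hull_comb ?fsubsetIl // in_fsetI (negPf pK') andbF.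
Qed.

Lemma star_eq_fsub K K' : K \in T -> K' \in T -> (K `<=` K')%fset -> K = K'.
Proof.
move=> /star_simplex0[[cK _] _] /star_simplex0[[cK' _] _] KK'.
by apply/eqP; rewrite eqEfcard KK' cK cK' /=.
Qed.

(** Contrapositive of [conforming_dual]: a common point that involves every nonzero vertex of [S]
    forces [S] into [K']. *)
Lemma fsub_of_coords K K' x (S : {fset 'rV[R]_d}) : K \in T -> K' \in T ->
  (S `<=` K)%fset -> cone K x -> cone K' x ->
  (forall p, p \in S -> p != 0 -> dot (dual K p) x != 0) -> (S `<=` K')%fset.
Proof.
move=> KT K'T SK Kx K'x Sx; apply/fsubsetP => p pS.
have [->|p0] := eqVneq p 0; first by have [_] := star_simplex0 K'T.
apply: contraT => pK'; have := Sx p pS p0; rewrite (conforming_dual KT K'T) ?eqxx //.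
by rewrite in_fsetD1 p0 (fsubsetP SK).
Qed.

Lemma cone_interior_inj K K' x : K \in T -> K' \in T ->
  in_cone_interior K x -> cone K' x -> K = K'.
Proof.
move=> KT K'T Kx K'x; apply: star_eq_fsub => //.
apply: (fsub_of_coords KT K'T (fsubset_refl K) (cone_interior_cone Kx) K'x).
by move=> p pK p0; rewrite gt_eqF // Kx // in_fsetD1 p0.
Qed.

End StarGeometry.

(** * Each facet through the origin lies in exactly two elements *)

Section Facets.
Context (R : realType) (d : nat) (T : {fset {fset 'rV[R]_d}}).
Hypothesis starT : is_star T.
Implicit Types (F K : {fset 'rV[R]_d}) (p q x : 'rV[R]_d).

Lemma facet_vertex K F : simplex0 K -> (F `<=` K)%fset -> #|` F|%fset = d ->
  0 \in F -> exists2 a, a \in (K `\ 0)%fset & F = (K `\ a)%fset.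
Proof.
move=> [[cK _] _] FK cF F0.
have /eqP/cardfs1P[a aE] : #|` (K `\` F)%fset| = 1%N.
  have := cardfsD K F; rewrite (fsetIidPr FK) => ->.
  by rewrite cK [X in (_ - X)%N]cF subSnn.
have : a \in (K `\` F)%fset by rewrite aE inE.
rewrite in_fsetD => /andP[aF aK].
exists a; first by rewrite in_fsetD1 aK andbT; apply: contraNneq aF => ->.
by rewrite -aE fsetDK.
Qed.

(** Both forms vanish on the common facet, hence are proportional; evaluation at [b] gives the
    factor. *)
Lemma facet_dual K K' a b : simplex0 K -> simplex0 K' ->
  a \in (K `\ 0)%fset -> b \in (K' `\ 0)%fset -> (K `\ a = K' `\ b)%fset ->
  dual K a = dot (dual K a) b *: dual K' b.
Proof.
move=> sK sK' aK bK' eF; apply: (dot_inj_vertices sK') => p pK'.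
rewrite dotZl; have [->|pb] := eqVneq p b.
  by rewrite (dual_dot sK') // eqxx mulr1.
rewrite (dual_dot sK') // eq_sym (negPf pb) mulr0.
have : p \in (K `\ a)%fset.
  by rewrite eF in_fsetD1 pb; move: pK'; rewrite in_fsetD1 => /andP[].
rewrite in_fsetD1 => /andP[pa pK].
have pB : p \in (K `\ 0)%fset.
  by rewrite in_fsetD1 pK; move: pK'; rewrite in_fsetD1 => /andP[->].
by rewrite (dual_dot sK aK pB) eq_sym (negPf pa).
Qed.

Lemma facet_dual_neq0 K K' a b : simplex0 K -> simplex0 K' ->
  a \in (K `\ 0)%fset -> b \in (K' `\ 0)%fset -> (K `\ a = K' `\ b)%fset ->
  dot (dual K a) b != 0.
Proof.
move=> sK sK' aK bK' eF; apply/eqP => vb.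
have := dual_dot sK aK aK; rewrite (facet_dual sK sK' aK bK' eF) vb.
by rewrite scale0r dot0l eqxx => /esym/eqP; rewrite oner_eq0.
Qed.

(* Elements on the same side of a common facet would overlap. *)
Lemma facet_opposite K K' a b : K \in T -> K' \in T -> K != K' ->
  a \in (K `\ 0)%fset -> b \in (K' `\ 0)%fset -> (K `\ a = K' `\ b)%fset ->
  dot (dual K a) b < 0.
Proof.
move=> KT K'T /eqP neK aK bK' eF.
have sK := star_simplex0 starT KT; have sK' := star_simplex0 starT K'T.
rewrite lt_neqAle (facet_dual_neq0 sK sK' aK bK' eF) /= leNgt; apply/negP => vb; apply: neK.
(* The weights [c q] outweigh the possibly negative coordinates of [b] in [K]: adding them along [F]
   gives a point interior to the cone of [K'] that also lies in the cone of [K]. *)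
pose F := (K `\ a)%fset; pose c q := 1 + `|dot (dual K q) b|.
have FK : (F `<=` K)%fset by apply: fsubD1set.
have FK' : (F `<=` K')%fset by rewrite /F eF; apply: fsubD1set.
apply/esym/(@cone_interior_inj _ _ _ starT _ _ (b + \sum_(q <- F) c q *: q)) => // p pB;
  rewrite dotDr hull_comb //.
- rewrite dual_dot // /F eF in_fsetD1; have [->|pb] := eqVneq p b.
    by rewrite /= addr0.
  move: pB; rewrite in_fsetD1 => /andP[_ ->].
  by rewrite /= add0r ltr_pwDl.
- rewrite in_fsetD1; have [->|pa] := eqVneq p a.
    by rewrite addr0 ltW.
  move: pB; rewrite in_fsetD1 => /andP[_ ->] /=.
  have := ler_norm (- dot (dual K p) b); rewrite normrN /c; lra.
Qed.

(** Three elements would lie pairwise on opposite sides of the hyperplane of [F], but there are only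
    two sides. *)
Lemma facet_at_most_two K K' K'' F : K \in T -> K' \in T -> K'' \in T ->
  #|` F|%fset = d -> 0 \in F ->
  (F `<=` K)%fset -> (F `<=` K')%fset -> (F `<=` K'')%fset ->
  K != K' -> K != K'' -> K' = K''.
Proof.
move=> KT K'T K''T cF F0 FK FK' FK'' n1 n2; apply/eqP; apply: contraT => n3.
have sK := star_simplex0 starT KT; have sK' := star_simplex0 starT K'T.
have sK'' := star_simplex0 starT K''T.
have [a aK aF] := facet_vertex sK FK cF F0.
have [b bK bF] := facet_vertex sK' FK' cF F0.
have [c cK cE] := facet_vertex sK'' FK'' cF F0.
have vb : dot (dual K a) b < 0 by apply: (facet_opposite KT K'T) => //; rewrite -aF.
have vc : dot (dual K a) c < 0 by apply: (facet_opposite KT K''T) => //; rewrite -aF.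
have wc : dot (dual K' b) c < 0 by apply: (facet_opposite K'T K''T) => //; rewrite -bF.
move: vc; rewrite (facet_dual sK sK' aK bK) -?aF // dotZl.
by rewrite ltNge nmulr_lge0 // ltW.
Qed.

(** Step out of [K] from a relative interior point of the cone over [F], in the direction [- a]. If
    the step is short, the element that covers the new point also contains the old one, hence
    [F]. *)
Lemma facet_at_least_two K F : K \in T -> (F `<=` K)%fset -> #|` F|%fset = d ->
  0 \in F -> exists K', [/\ K' \in T, (F `<=` K')%fset & K != K'].
Proof.
move=> KT FK cF F0; have sK := star_simplex0 starT KT.
have [a aK aF] := facet_vertex sK FK cF F0.
pose x := \sum_(q <- F) (1 : R) *: q.
have Kx : cone K x.
  by move=> p pK; rewrite (hull_comb (fun=> 1)) //; case: ifP.
(* An inequality of [K'] violated at [x] stays violated nearby; there are finitely many of them. *)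
have [e e0 he] : exists2 e : R, 0 < e & forall K', K' \in T -> forall t, 0 < t <= e ->
    cone K' (x - t *: a) -> cone K' x.
  apply: uniform_threshold => K' K'T.
  suff : exists2 e : R, 0 < e & forall p, p \in (K' `\ 0)%fset -> forall t, 0 < t <= e ->
      0 <= dot (dual K' p) (x - t *: a) -> 0 <= dot (dual K' p) x.
    move=> [e e0 he]; exists e => // t te h p pK'.
    by apply: he te _ => //; apply: h.
  apply: uniform_threshold => p pK'.
  have [h|h] := leP 0 (dot (dual K' p) x); first by exists 1.
  set m := dot _ x in h *; pose s := dot (dual K' p) a.
  (* Keeps [t * |s|] at most [- m / 2], so the form is still negative after the step and the
     implication is vacuous. *)
  exists (- m / (2 * (1 + `|s|))).
    by rewrite divr_gt0 ?oppr_gt0 // mulr_gt0 // ltr_pwDl.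
  move=> t /andP[t0 te]; rewrite dotBr dotZr -/m -/s.
  have t1 : t * (1 + `|s|) <= - m / 2.
    by rewrite -ler_pdivlMr ?ltr_pwDl // -mulrA -invfM.
  have : t * - s <= t * `|s| by rewrite ler_pM2l // -normrN ler_norm.
  by lra.
have [K' K'T K'x] := cone_cover starT (x - e *: a).
have K'x0 : cone K' x by apply: he K'x => //; rewrite e0 lexx.
exists K'; split => //.
  apply: (fsub_of_coords starT KT K'T FK Kx K'x0) => p pF p0.
  by rewrite (hull_comb (fun=> 1)) ?pF ?oner_eq0 // in_fsetD1 p0 (fsubsetP FK).
apply/eqP => E; have := K'x a; rewrite -E => /(_ aK).
rewrite dotBr dotZr (dual_dot sK aK aK) eqxx (hull_comb (fun=> 1)) //.
by rewrite aF in_fsetD1 eqxx /= sub0r mulr1 oppr_ge0 leNgt e0.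
Qed.

End Facets.

(** * Gradients of a convex function, and outer normals *)

Section Gradients.
Context (R : realType) (d : nat) (T : {fset {fset 'rV[R]_d}}).
Context (gamma : 'rV[R]_d -> R).
Hypothesis starT : is_star T.
Hypothesis affineT : piecewise_affine T gamma.
Hypothesis convexT : convex_on_star (star_domain T) gamma.
Hypothesis gamma0 : gamma 0 = 0.
Implicit Types (F K : {fset 'rV[R]_d}) (p q x y : 'rV[R]_d).

Lemma gradE K x : K \in T -> hull K x -> gamma x = dot (grad gamma K) x.
Proof.
move=> KT Kx; have [c cE] : affine_with_gradient gamma (hull K) (grad gamma K).
  exact: (@xgetPex _ _ [set g | affine_with_gradient gamma (hull K) g] (affineT.2 K KT)).
have [_ K0] := star_simplex0 starT KT.
have := cE 0 (hull_vertex K0); rewrite gamma0 dot0r add0r => c0.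
by rewrite cE // -c0 addr0.
Qed.

Lemma convex_on_star_le x y s : 0 <= s <= 1 ->
  star_domain T x -> star_domain T y -> star_domain T ((1 - s) *: x + s *: y) ->
  gamma ((1 - s) *: x + s *: y) <= (1 - s) * gamma x + s * gamma y.
Proof.
move=> s01 Tx Ty Tz; have [g gconv gE] := convexT.
rewrite !gE ?inE //.
have s1 : 0 <= 1 - s <= 1 by lra.
have := gconv (Itv01 (andP s1).1 (andP s1).2) x y (in_setT _) (in_setT _).
by rewrite convRE /= /conv /= /unstable.onem subKr.
Qed.

(** Start at [y] interior to the cone of [K] and move slightly towards [x], to [z] in the same cone.
    After scaling into the star, [gamma] at [y] and [z] is given by the gradient on [K], and
    convexity along the segment from [y] to [x] compares the two gradients at [x]. *)
Lemma grad_max K K' x : K \in T -> K' \in T -> cone K' x ->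
  dot (grad gamma K) x <= dot (grad gamma K') x.
Proof.
move=> KT K'T K'x; have [y Ky] := cone_interior_exists starT KT.
have sK := star_simplex0 starT KT; have sK' := star_simplex0 starT K'T.
have [e e0 he] : exists2 e : R, 0 < e & forall p, p \in (K `\ 0)%fset ->
    forall s, 0 < s <= e -> 0 <= dot (dual K p) ((1 - s) *: y + s *: x).
  apply: uniform_threshold => p pK; have m0 := Ky p pK.
  set m := dot _ y in m0; pose l := dot (dual K p) x.
  have ml0 : 0 < m + `|l| by rewrite ltr_pwDl.
  exists (m / (m + `|l|)); first by rewrite divr_gt0.
  move=> s /andP[s0]; rewrite ler_pdivlMr // dotDr !dotZr -/m -/l => sm.
  have : s * - l <= s * `|l| by rewrite ler_pM2l // -normrN ler_norm.
  by lra.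
(* The bound [1 / 2] makes [s] a convex weight. *)
pose s := Num.min e (1 / 2).
have s0 : 0 < s by rewrite lt_min e0; lra.
have s1 : s <= 1 / 2 by rewrite ge_min lexx orbT.
pose z := (1 - s) *: y + s *: x.
have Kz : cone K z by move=> p pK; apply: he => //; rewrite s0 ge_min lexx.
have [ex ex0 hx] := cone_hull sK' K'x.
have [ey ey0 hy] := cone_hull sK (cone_interior_cone Ky).
have [ez ez0 hz] := cone_hull sK Kz.
pose r := Num.min ex (Num.min ey ez).
have r0 : 0 < r by rewrite !lt_min ex0 ey0.
have {}hx : hull K' (r *: x) by apply: hx; rewrite r0 ge_min lexx.
have {}hy : hull K (r *: y) by apply: hy; rewrite r0 !ge_min lexx orbT.
have {}hz : hull K (r *: z) by apply: hz; rewrite r0 !ge_min lexx !orbT.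
have zE : r *: z = (1 - s) *: (r *: y) + s *: (r *: x).
  by rewrite /z scalerDr !scalerA !(mulrC r).
have : gamma (r *: z) <= (1 - s) * gamma (r *: y) + s * gamma (r *: x).
  rewrite zE; apply: convex_on_star_le; first by rewrite ltW //=; lra.
  - by exists K.
  - by exists K'.
  - by rewrite -zE; exists K.
rewrite (gradE KT hz) (gradE KT hy) (gradE K'T hx) zE dotDr !dotZr lerD2l.
by rewrite !ler_pM2l.
Qed.

Lemma subdifferential_le K w x : K \in T -> cone K x ->
  subdifferential0 (star_domain T) gamma w -> dot w x <= dot (grad gamma K) x.
Proof.
move=> KT Kx /= wP; have [e e0 he] := cone_hull (star_simplex0 starT KT) Kx.
have he' : hull K (e *: x) by apply: he; rewrite e0 lexx.
have := wP (e *: x) (ex_intro2 _ _ K KT he').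
by rewrite gamma0 addr0 (gradE KT he') !dotZr ler_pM2l.
Qed.

Lemma outer_unit_normal_exists K a : K \in T -> a \in (K `\ 0)%fset ->
  is_outer_unit_normal K (K `\ a)%fset (outer_unit_normal K (K `\ a)%fset).
Proof.
move=> KT aK; have sK := star_simplex0 starT KT.
apply: (@xgetPex _ _ [set n | is_outer_unit_normal K (K `\ a)%fset n]).
set v := dual K a.
have v0 : v != 0.
  apply/eqP => v0; have := dual_dot sK aK aK.
  by rewrite -/v v0 dot0l eqxx => /esym/eqP; rewrite oner_eq0.
have vF x : hull (K `\ a)%fset x -> dot v x = 0.
  move=> [c [_ _ ->]]; rewrite hull_comb ?fsubD1set //.
  by rewrite in_fsetD1 eqxx.
have vv := dot_gt0 v0; have sv : 0 < Num.sqrt (dot v v) by rewrite sqrtr_gt0.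
(* The form [v] vanishes on the facet and is nonnegative on [K], so the outward direction is
   [- v]. *)
exists (- (Num.sqrt (dot v v))^-1 *: v); split.
- rewrite dotZl dotZr mulrA mulrNN -expr2 exprVn sqr_sqrtr ?ltW //.
  by rewrite mulVf // gt_eqF.
- by move=> x y Fx Fy; rewrite dotZl dotBr (vF x) // (vF y) // subrr mulr0.
- move=> x y Kx Fy; rewrite dotZl dotBr (vF y) // subr0 mulNr oppr_le0.
  rewrite mulr_ge0 ?invr_ge0 ?(ltW sv) //.
  exact: (hull_cone sK Kx).
Qed.

(** Orthogonality to the facet leaves only multiples of [dual K a]. The sign of [c] and its
    normalization determine it without a square root. *)
Lemma outer_unit_normalE K a : K \in T -> a \in (K `\ 0)%fset ->
  exists c, [/\ c < 0, outer_unit_normal K (K `\ a)%fset = c *: dual K a &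
    c ^+ 2 * dot (dual K a) (dual K a) = 1].
Proof.
move=> KT aK; have sK := star_simplex0 starT KT; have [_ K0] := sK.
have [] := outer_unit_normal_exists KT aK; set n := outer_unit_normal _ _.
move=> n1 nF nK; have aK' := aK; move: aK'; rewrite in_fsetD1 => /andP[a0 aK'].
have F0 : hull (K `\ a)%fset 0.
  by apply: hull_vertex; rewrite in_fsetD1 K0 eq_sym a0.
have nE : n = dot n a *: dual K a.
  apply: (dot_inj_vertices sK) => p pB; rewrite dotZl dual_dot //.
  have [->|pa] := eqVneq p a; first by rewrite mulr1.
  rewrite mulr0 -[p]subr0; apply: nF => //.
  apply: hull_vertex; rewrite in_fsetD1 pa.
  by move: pB; rewrite in_fsetD1 => /andP[].
have na : dot n a <= 0.
  by have := nK a 0 (hull_vertex aK') F0; rewrite subr0.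
exists (dot n a); split => //; last first.
  by rewrite -n1 [in RHS]nE dotZl dotZr mulrA expr2.
rewrite lt_neqAle na andbT; apply/eqP => na0.
by move: n1; rewrite nE na0 scale0r dot0l => /esym/eqP; rewrite oner_eq0.
Qed.

End Gradients.

(** * Jumps as norms of gradient differences *)

Section Jumps.
Context (R : realType) (d : nat) (T : {fset {fset 'rV[R]_d}}).
Context (gamma : 'rV[R]_d -> R).
Hypothesis starT : is_star T.
Hypothesis affineT : piecewise_affine T gamma.
Hypothesis convexT : convex_on_star (star_domain T) gamma.
Hypothesis gamma0 : gamma 0 = 0.
Implicit Types (F K : {fset 'rV[R]_d}) (p q x y : 'rV[R]_d).

Lemma faces0P F : reflect
  [/\ exists2 K, K \in T & (F `<=` K)%fset, #|` F|%fset = d & 0 \in F]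
  (F \in faces0 T).
Proof.
rewrite /faces0 !inE /=; apply: (iffP and3P) => -[].
  move=> /bigfcupP[K]; rewrite andbT fpowersetE => KT FK /eqP cF F0.
  by split=> //; exists K.
move=> [K KT FK] cF F0; split => //; last exact/eqP.
by apply/bigfcupP; exists K; rewrite ?KT // fpowersetE.
Qed.

(** The gradient difference vanishes on [F], so it is normal to it, and convexity fixes its
    orientation. As the two unit normals are opposite, the jump is its Euclidean norm. *)
Lemma jump_pair K K' F : K \in T -> K' \in T -> K != K' ->
  (F `<=` K)%fset -> (F `<=` K')%fset -> #|` F|%fset = d -> 0 \in F ->
  0 <= jump T gamma F /\
  jump T gamma F ^+ 2 =
    dot (grad gamma K - grad gamma K') (grad gamma K - grad gamma K').
Proof.
move=> KT K'T nK FK FK' cF F0.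
have sK := star_simplex0 starT KT; have sK' := star_simplex0 starT K'T.
have [a aK aF] := facet_vertex sK FK cF F0.
have [b bK bF] := facet_vertex sK' FK' cF F0.
have eF : (K `\ a = K' `\ b)%fset by rewrite -aF.
rewrite (@jumpE _ _ _ _ _ K K') // => [|K'']; last first.
  apply/andP/orP => [[K''T FK'']|[/eqP->|/eqP->]] //.
  have [->|n] := eqVneq K'' K; [by left|right].
  by rewrite (facet_at_most_two starT KT K'T K''T cF F0) // eq_sym.
have [c [c0 nE cv]] := outer_unit_normalE starT KT aK.
have [c' [c'0 n'E c'v]] := outer_unit_normalE starT K'T bK.
rewrite -aF in nE; rewrite -bF in n'E; rewrite nE n'E.
have vE := facet_dual sK sK' aK bK eF.
have vb := facet_opposite starT KT K'T nK aK bK eF.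
set v := dual K a in nE cv vE vb *; set v' := dual K' b in n'E c'v vE *.
set m := dot v b in vE vb.
have v'0 : dot v' v' != 0.
  by apply/eqP => z; move: c'v; rewrite z mulr0 => /esym/eqP; rewrite oner_eq0.
(* The normals are unit multiples of the same [v'], so they agree up to sign; [m < 0], as the
   elements lie on opposite sides, decides the sign. *)
have cm : c * m = - c'.
  have : (c * m) ^+ 2 = c' ^+ 2.
    apply: (mulIf v'0); rewrite c'v -cv vE dotZl dotZr; ring.
  move/eqP; rewrite eqf_sqr => /orP[/eqP E|/eqP //].
  by have : 0 < c * m by [rewrite nmulr_rgt0]; rewrite E ltNge ltW.
have n'v : c' *: v' = - (c *: v) by rewrite vE scalerA cm scaleNr opprK.
have k0 : 0 <= dot (grad gamma K - grad gamma K') a.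
  rewrite dotBl subr_ge0.
  apply: (grad_max starT affineT convexT gamma0 K'T KT); apply: cone_vertex => //.
  by move: aK; rewrite in_fsetD1 => /andP[].
set k := dot _ a in k0.
(* A vertex of [F] lies in both cones, so [grad_max] applies in both directions there. *)
have gE : grad gamma K - grad gamma K' = k *: v.
  apply: (dot_inj_vertices sK) => p pK; rewrite dotZl (dual_dot sK aK pK).
  have [->|pa] := eqVneq p a; first by rewrite mulr1.
  rewrite mulr0.
  have pF : p \in F.
    by rewrite aF in_fsetD1 pa; move: pK; rewrite in_fsetD1 => /andP[].
  have Kp : cone K p by apply: cone_vertex => //; apply: (fsubsetP FK).
  have K'p : cone K' p by apply: cone_vertex => //; apply: (fsubsetP FK').
  by apply/eqP; rewrite dotBl subr_eq0 eq_le !(grad_max starT affineT convexT gamma0).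
have -> : - dot (c *: v) (grad gamma K) - dot (c' *: v') (grad gamma K') =
    - c * (k * dot v v).
  rewrite n'v -scaleNr !dotZl -[k * dot v v]dotZr -gE dotBr; ring.
have vv : 0 <= dot v v by rewrite /dot sumr_ge0 // => i _; rewrite -expr2 sqr_ge0.
split; first by rewrite !mulr_ge0 // oppr_ge0 ltW.
rewrite gE dotZl dotZr -[RHS]mul1r -cv; ring.
Qed.

Lemma jump_ge0 F : F \in faces0 T -> 0 <= jump T gamma F.
Proof.
move=> /faces0P[[K KT FK] cF F0].
have [K' [K'T FK' nK]] := facet_at_least_two starT KT FK cF F0.
by have [] := jump_pair KT K'T nK FK FK' cF F0.
Qed.

Lemma grad_sub_le_jump K K' F i : K \in T -> K' \in T -> K != K' ->
  (F `<=` K)%fset -> (F `<=` K')%fset -> #|` F|%fset = d -> 0 \in F ->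
  grad gamma K 0 i - grad gamma K' 0 i <= jump T gamma F.
Proof.
move=> KT K'T nK FK FK' cF F0.
have [j0 jE] := jump_pair KT K'T nK FK FK' cF F0.
have := sqr_coord_le_dot (grad gamma K - grad gamma K') i.
rewrite -jE !mxE => h; apply: le_trans (ler_norm _) _.
by rewrite -(ler_pXn2r (n := 2)) ?nnegrE ?normr_ge0 // real_normK // num_real.
Qed.

End Jumps.

(** * Connecting elements through facets along a generic line *)

Section Connectivity.
Context (R : realType) (d : nat) (T : {fset {fset 'rV[R]_d}}).
Hypothesis starT : is_star T.
Implicit Types (F K : {fset 'rV[R]_d}) (p q x y : 'rV[R]_d).

(** The integers from 1 to [size P] are more numerous than the roots. *)
Lemma poly_nonroot_gt0 (P : {poly R}) : P != 0 -> exists2 s : R, 0 < s & P.[s] != 0.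
Proof.
move=> P0; pose rs : seq R := [seq i.+1%:R | i <- iota 0 (size P)].
have urs : uniq rs.
  by rewrite map_inj_uniq ?iota_uniq // => i j /eqP; rewrite eqr_nat => /eqP[].
have [|/allPn[s /mapP[i _ ->] Ps]] := boolP (all (root P) rs).
  by move=> /(max_poly_roots P0)/(_ urs); rewrite size_map size_iota ltnn.
by exists i.+1%:R.
Qed.

(* On the curve [s |-> \sum_i s ^+ i *: p_i] a nonzero linear form is a nonzero
   polynomial in [s]. *)
Lemma cone_interior_generic K (N : seq 'rV[R]_d) : K \in T ->
  exists2 x, in_cone_interior K x & forall n, n \in N -> n != 0 -> dot n x != 0.
Proof.
move=> KT; have sK := star_simplex0 starT KT.
pose B := (K `\ 0)%fset; have sB : size B = d := size_simplex0 sK.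
pose P n : {poly R} := \poly_(i < d) dot n (nth 0 B i).
have P0 n : n != 0 -> P n != 0.
  apply: contra_neq => Pn0; apply: (dot_inj_vertices sK) => p pB.
  rewrite dot0l; have ip : (index p B < d)%N by rewrite -[ltnRHS]sB index_mem.
  have := congr1 (fun Q : {poly R} => Q`_(index p B)) Pn0.
  by rewrite coef0 coef_poly ip nth_index.
(* Taking the product yields one [s] for all the forms. *)
have [s s0 Ps] : exists2 s : R, 0 < s & (\prod_(n <- N | n != 0) P n).[s] != 0.
  apply: poly_nonroot_gt0; rewrite prodf_seq_neq0.
  by apply/allP => n _; apply/implyP/P0.
exists (\sum_(p <- B) s ^+ index p B *: p) => [p pB|n nN n0].
  by rewrite (dual_comb (fun p => s ^+ index p B)) // exprn_gt0.
have -> : dot n (\sum_(p <- B) s ^+ index p B *: p) = (P n).[s].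
  rewrite dot_sumr (big_nth 0) sB big_mkord horner_poly; apply: eq_bigr => i _.
  by rewrite dotZr index_uniq ?fset_uniq ?sB // mulrC.
move: Ps; rewrite horner_prod prodf_seq_neq0 => /allP/(_ n nN).
by rewrite n0.
Qed.

Definition line x y (t : R) := x + t *: (y - x).

(** Choose [x1] off all facet hyperplanes, then [x2] off every hyperplane spanned by [x1] and the
    intersection of two facet hyperplanes of an element. The form [(u x1) v - (v x1) u] defines the
    latter. *)
Lemma generic_line K1 K2 : K1 \in T -> K2 \in T -> exists x1 x2,
  [/\ in_cone_interior K1 x1, in_cone_interior K2 x2 &
    forall K a b t, K \in T -> a \in (K `\ 0)%fset -> b \in (K `\ 0)%fset ->
      dot (dual K a) (line x1 x2 t) = 0 -> dot (dual K b) (line x1 x2 t) = 0 ->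
      a = b].
Proof.
move=> K1T K2T.
pose D := [seq dual K a | K <- T, a <- (K `\ 0)%fset].
have DP K a : K \in T -> a \in (K `\ 0)%fset -> dual K a \in D /\ dual K a != 0.
  move=> KT aK; have sK := star_simplex0 starT KT; split.
    by apply/allpairsPdep; exists K, a.
  apply/eqP => v0; have := dual_dot sK aK aK.
  by rewrite v0 dot0l eqxx => /esym/eqP; rewrite oner_eq0.
have [x1 Kx1 gx1] := cone_interior_generic D K1T.
have [x2 Kx2 gx2] := cone_interior_generic
  [seq dot u x1 *: v - dot v x1 *: u | u <- D, v <- D] K2T.
exists x1, x2; split=> // K a b t KT aK bK; set u := dual K a; set v := dual K b.
have [uD u0] := DP K a KT aK; have [vD v0] := DP K b KT bK.
rewrite /line !dotDr !dotZr !dotBr => hu hv; apply/eqP; apply: contraT => ab.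
pose n := dot u x1 *: v - dot v x1 *: u.
have ux1 : dot u x1 != 0 by apply: gx1.
have n0 : n != 0.
  apply/eqP => n0; have := dot0l b; rewrite -n0 dotBl !dotZl.
  have sK := star_simplex0 starT KT.
  rewrite (dual_dot sK bK bK) (dual_dot sK aK bK) eqxx (negPf ab) mulr0 subr0 mulr1 => e.
  by rewrite e eqxx in ux1.
have nx2 : dot n x2 != 0 by apply: gx2 => //; apply: allpairs_f.
have t0 : t != 0.
  by apply: contra_neq ux1 => t0; rewrite t0 mul0r addr0 in hu.
(* The form [n] vanishes at [x1] and, where [u] and [v] both vanish, at the point of the line. *)
have : t * dot n x2 = 0.
  rewrite dotBl !dotZl.
  have -> : t * (dot u x1 * dot v x2 - dot v x1 * dot u x2) =
    dot u x1 * (dot v x1 + t * (dot v x2 - dot v x1)) -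
    dot v x1 * (dot u x1 + t * (dot u x2 - dot u x1)) by ring.
  by rewrite hu hv !mulr0 subrr.
by move/eqP; rewrite mulf_eq0 (negPf t0) (negPf nx2).
Qed.

Lemma closed_line_cone K x y : closed [set t | cone K (line x y t)].
Proof.
have -> : [set t | cone K (line x y t)] =
    \bigcap_(p in [set` (K `\ 0)%fset])
      (fun t => dot (dual K p) (line x y t)) @^-1` [set s | 0 <= s].
  by apply/seteqP; split => t h p; apply: h.
apply: closed_bigI => p _; apply: closed_comp; last exact: closed_ge.
move=> t _.
have -> : (fun t => dot (dual K p) (line x y t)) =
    (fun t => dot (dual K p) x + t * dot (dual K p) (y - x)).
  by apply/funext => s; rewrite /line dotDr dotZr.
by apply: cvgD; [exact: cvg_cst|apply: cvgM; [exact: cvg_id|exact: cvg_cst]].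
Qed.

(** For elements of a star the [d] common vertices include 0, so they form a face through the
    origin. *)
Definition share_facet K K' : bool := (K != K') && (#|` (K `&` K')%fset| == d).

(* Along a generic line the element changes only across facets, so the two
   closed sets of parameters covered by [A] and by its complement are disjoint. *)
Lemma share_facet_connected (A : pred {fset 'rV[R]_d}) K1 K2 :
  (forall K K', K \in T -> K' \in T -> A K -> share_facet K K' -> A K') ->
  K1 \in T -> K2 \in T -> A K1 -> A K2.
Proof.
move=> adjA K1T K2T A1; have [x1 [x2 [Kx1 Kx2 gen]]] := generic_line K1T K2T.
pose S (P : pred {fset 'rV[R]_d}) :=
  \bigcup_(K in [set K | K \in T /\ P K]) [set t | cone K (line x1 x2 t)].
have closedS P : closed (S P).
  apply: closed_bigcup => [|K _]; last exact: closed_line_cone.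
  by apply: (@sub_finite_set _ _ [set` T]) => [K []//|]; apply: finite_fset.
have SC : S A = ~` S (predC A).
  apply/seteqP; split => t.
    move=> [K [KT AK] /= Kt] [K' [K'T /= nAK'] K't].
    have nK : K != K' by apply: contraNneq nAK' => <-.
    (* Every vertex of [K] missing from [K'] has coordinate 0 at the common point, so genericity
       allows only one. *)
    have dual0 p : p \in (K `\` K')%fset ->
        p \in (K `\ 0)%fset /\ dot (dual K p) (line x1 x2 t) = 0.
      rewrite in_fsetD => /andP[pK' pK]; have [_ K'0] := star_simplex0 starT K'T.
      have pB : p \in (K `\ 0)%fset.
        by rewrite in_fsetD1 pK andbT; apply: contraNneq pK' => ->.
      by split => //; apply: (conforming_dual starT KT K'T).
    move/negP: nAK'; apply; apply: (adjA K) => //; rewrite /share_facet nK /=.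
    have [[cK _] _] := star_simplex0 starT KT.
    have [p pD] : exists p, p \in (K `\` K')%fset.
      apply/fset0Pn; rewrite fsetD_eq0; apply: contra_neqN nK.
      exact: (star_eq_fsub starT KT K'T).
    have cD : #|` (K `\` K')%fset| = 1%N.
      apply/eqP/cardfs1P; exists p; apply/fsetP => q.
      apply/idP/fset1P => [qD|->//]; have [pB p0] := dual0 p pD.
      by have [qB q0] := dual0 q qD; apply: gen q0 p0.
    by have := cardfsID K' K; rewrite cK cD addn1 => /eqP; rewrite eqSS.
  move=> nS; have [K KT Kt] := cone_cover starT (line x1 x2 t).
  exists K => //; split => //; apply: contra_notT nS => nAK; by exists K.
have line0 : line x1 x2 0 = x1 by rewrite /line scale0r addr0.
have line1 : line x1 x2 1 = x2 by rewrite /line scale1r addrC subrK.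
(* [S A] is both open and closed and contains 0, so it covers the segment; at parameter 1 only [K2]
   is available. *)
have : `[0, 1]%classic `&` S A = `[0, 1]%classic.
  apply: (@segment_connected R 0 1).
  - exists 0; split; first by rewrite /= in_itv /= lexx ler01.
    by exists K1 => //=; rewrite line0; apply: cone_interior_cone.
  - by exists (S A) => //; rewrite SC; apply: closed_openC.
  - by exists (S A).
move=> /seteqP[_ /(_ 1)] [|_ [K [KT AK]]].
  by rewrite /= in_itv /= lexx ler01.
rewrite /= line1 => Kx; by rewrite (cone_interior_inj starT K2T KT Kx2 Kx).
Qed.

End Connectivity.

(** * Summing the jumps along a chain of elements *)

Section GradientOscillation.
Context (R : realType) (d : nat) (T : {fset {fset 'rV[R]_d}}).
Context (gamma : 'rV[R]_d -> R).
Hypothesis starT : is_star T.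
Hypothesis affineT : piecewise_affine T gamma.
Hypothesis convexT : convex_on_star (star_domain T) gamma.
Hypothesis gamma0 : gamma 0 = 0.
Implicit Types (F K : {fset 'rV[R]_d}).

Fixpoint path_facets K (s : seq {fset 'rV[R]_d}) : seq {fset 'rV[R]_d} :=
  if s is K' :: s' then (K `&` K')%fset :: path_facets K' s' else [::].

Lemma path_facetsP K s F : uniq (K :: s) -> F \in path_facets K s ->
  exists K1 K2, [/\ K1 \in K :: s, K2 \in K :: s, K1 != K2 &
    (F = K1 `&` K2)%fset].
Proof.
elim: s K => //= K' s IH K /andP[]; rewrite inE negb_or => /andP[nK Ks] us.
rewrite inE => /predU1P[->|FS].
  by exists K, K'; rewrite !inE !eqxx orbT.
have [K1 [K2 [h1 h2 n12 FE]]] := IH K' us FS.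
by exists K1, K2; rewrite !(in_cons K) h1 h2 !orbT.
Qed.

Lemma share_facet_faces0 K K' : K \in T -> K' \in T -> share_facet K K' ->
  (K `&` K')%fset \in faces0 T.
Proof.
move=> KT K'T /andP[_ /eqP cF]; apply/faces0P; split => //.
  by exists K => //; apply: fsubsetIl.
have [_ K0] := star_simplex0 starT KT; have [_ K'0] := star_simplex0 starT K'T.
by rewrite in_fsetI K0.
Qed.

Lemma path_facets_faces0 K s : all (mem T) (K :: s) -> path (@share_facet R d) K s ->
  {subset path_facets K s <= faces0 T}.
Proof.
elim: s K => //= K' s IH K /and3P[KT K'T sT] /andP[aK pK] F.
rewrite inE => /predU1P[->|]; first exact: share_facet_faces0.
by apply: IH => //=; rewrite K'T.
Qed.

(** If the first facet recurred, it would lie in [K] and in two distinct later elements,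
    contradicting [facet_at_most_two]. *)
Lemma uniq_path_facets K s : all (mem T) (K :: s) -> path (@share_facet R d) K s ->
  uniq (K :: s) -> uniq (path_facets K s).
Proof.
elim: s K => //= K' s IH K /and3P[KT K'T sT] /andP[aK pK].
rewrite inE negb_or => /andP[/andP[nK Ks] us].
rewrite IH ?andbT //=; last by rewrite K'T.
apply/negP => FS; have [K1 [K2 [h1 h2 n12 FE]]] := path_facetsP us FS.
have inT X : X \in K' :: s -> X \in T.
  by rewrite inE => /predU1P[->//|]; apply: (allP sT).
have nX X : X \in K' :: s -> K != X.
  by rewrite inE => /predU1P[->//|Xs]; apply: contraNneq Ks => ->.
have /faces0P[_ cF F0] := share_facet_faces0 KT K'T aK.
move/eqP: n12; apply.
apply: (facet_at_most_two starT KT (inT _ h1) (inT _ h2) cF F0 _ _ _ (nX _ h1) (nX _ h2)).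
- exact: fsubsetIl.
- by rewrite FE fsubsetIl.
- by rewrite FE fsubsetIr.
Qed.

Lemma grad_sub_le_path K s i : all (mem T) (K :: s) -> path (@share_facet R d) K s ->
  grad gamma K 0 i - grad gamma (last K s) 0 i <=
    \sum_(F <- path_facets K s) jump T gamma F.
Proof.
elim: s K => [|K' s IH] K; first by rewrite big_nil subrr.
move=> /= /and3P[KT K'T sT] /andP[aK pK]; rewrite big_cons.
have /faces0P[_ cF F0] := share_facet_faces0 KT K'T aK.
have [nK _] := andP aK.
have := @grad_sub_le_jump R d T gamma starT affineT convexT gamma0 _ _ _ i KT K'T nK
  (fsubsetIl _ _) (fsubsetIr _ _) cF F0.
have : all (mem T) (K' :: s) by rewrite /= K'T.
by move=> /IH/(_ pK); lra.
Qed.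

Lemma grad_sub_le_sum_jump K1 K2 i : K1 \in T -> K2 \in T ->
  grad gamma K1 0 i - grad gamma K2 0 i <= \sum_(F <- faces0 T) jump T gamma F.
Proof.
move=> K1T K2T.
(* Elements form a finite type, so reachability is the boolean [connect], and [shortenP] removes
   repetitions from a path. *)
pose e : rel T := fun k k' => share_facet (val k) (val k').
pose A K := [exists k : T, (val k == K) && connect e [` K1T]%fset k].
have : A K2.
  apply: (share_facet_connected starT _ K1T K2T) => [K K' KT K'T|].
    move=> /existsP[k /andP[/eqP kK ck]] aK.
    apply/existsP; exists [` K'T]%fset; rewrite eqxx /=.
    by apply: connect_trans ck (connect1 _); rewrite /e kK.
  by apply/existsP; exists [` K1T]%fset; rewrite eqxx connect0.
case/existsP => k /andP[/eqP kK2 /connectP[p0 ep0 lp0]].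
move: ep0 lp0; case/shortenP => p ep up _ lp.
pose s := [seq val k | k <- p].
have aT : all (mem T) (K1 :: s).
  by rewrite /= K1T; apply/allP => _ /mapP[x _ ->]; apply: valP.
have ps : path (@share_facet R d) K1 s by rewrite -[K1]/(val [` K1T]%fset) path_map.
have us : uniq (K1 :: s).
  by rewrite -[K1]/(val [` K1T]%fset) -(map_cons val) map_inj_uniq //; apply: val_inj.
have ls : last K1 s = K2 by rewrite -kK2 lp -(last_map val).
have := grad_sub_le_path i aT ps; rewrite ls => /le_trans; apply.
have uf := uniq_path_facets aT ps us; have sf := path_facets_faces0 aT ps.
(* Distinct facets make the chain a subsum over [faces0 T]; the omitted jumps are nonnegative. *)
have -> : \sum_(F <- path_facets K1 s) jump T gamma F =
    \sum_(F <- faces0 T | F \in path_facets K1 s) jump T gamma F.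
  rewrite -[RHS]big_filter; apply: perm_big; apply: uniq_perm => //.
    by rewrite filter_uniq // fset_uniq.
  by move=> F; rewrite mem_filter; case: (boolP (F \in _)) => // /sf ->.
rewrite big_mkcond big_seq [leRHS]big_seq ler_sum // => F FT.
by case: ifP => // _; apply: (jump_ge0 starT affineT convexT gamma0).
Qed.

End GradientOscillation.

(** * Outer measure of a subset of a box *)

Section OuterMeasure.
Context (R : realType) (d : nat).

Lemma lebesgue_rV_le_box (A : set 'rV[R]_d) (a b : 'rV[R]_d) : (0 < d)%N ->
  (forall i, a 0 i <= b 0 i) -> A `<=` box a b ->
  (lebesgue_rV A <= (box_volume a b)%:E)%E.
Proof.
move=> d0 ab Aab.
(* The cover must be a sequence: the remaining boxes are the single point 0, of volume 0 because
   [0 < d]. *)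
pose c (k : nat) : 'rV[R]_d * 'rV[R]_d := if k is 0%N then (a, b) else (0, 0).
have vol0 : box_volume (0 : 'rV[R]_d) 0 = 0.
  by rewrite /box_volume (bigD1 (Ordinal d0)) //= subrr mul0r.
have -> : (box_volume a b)%:E = (\sum_(0 <= k <oo) (box_volume (c k).1 (c k).2)%:E)%E.
  rewrite nneseries_recl //= => [|[|k] _ /=].
  - by rewrite eseries0 ?adde0 // => -[|k] //= _ _; rewrite vol0.
  - by rewrite lee_fin prodr_ge0 // => i _; rewrite subr_ge0.
  - by rewrite vol0.
apply: ereal_inf_lbound; exists c => //; split=> [[|k] i //|x /Aab xab].
by exists 0%N.
Qed.

End OuterMeasure.

Theorem proposition5p2 (R : realType) (d : nat) (hd : (2 <= d)%N) :
  exists C : R,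
    forall (T : {fset {fset 'rV[R]_d}}) (gamma : 'rV[R]_d -> R),
      is_star T ->
      piecewise_affine T gamma ->
      convex_on_star (star_domain T) gamma ->
      gamma 0 = 0 ->
      (lebesgue_rV (subdifferential0 (star_domain T) gamma)
        <= (C * (\sum_(F <- faces0 T) jump T gamma F) ^+ d)%:E)%E.
Proof.
exists 1 => T gamma starT affineT convexT gamma0; rewrite mul1r.
have /choice[Kp KpP] : forall i : 'I_d, exists K, K \in T /\ cone K (delta_mx 0 i).
  by move=> i; have [K] := cone_cover starT (delta_mx 0 i); exists K.
have /choice[Km KmP] : forall i : 'I_d, exists K, K \in T /\ cone K (- delta_mx 0 i).
  by move=> i; have [K] := cone_cover starT (- delta_mx 0 i); exists K.
(* Testing a subgradient on [- delta_mx 0 i] and [delta_mx 0 i] bounds its [i]-th coordinate below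
   and above by these values. *)
pose a : 'rV[R]_d := \row_i grad gamma (Km i) 0 i.
pose b : 'rV[R]_d := \row_i grad gamma (Kp i) 0 i.
have ab i : a 0 i <= b 0 i.
  have [KpT Kpi] := KpP i; have [KmT _] := KmP i.
  rewrite !mxE -!dot_delta; exact: (grad_max starT affineT convexT gamma0 KmT KpT).
apply: (@le_trans _ _ (box_volume a b)%:E).
  apply: lebesgue_rV_le_box => // [|w wP i]; first exact: leq_trans hd.
  have [KpT Kpi] := KpP i; have [KmT Kmi] := KmP i.
  have := subdifferential_le starT affineT gamma0 KpT Kpi wP.
  have := subdifferential_le starT affineT gamma0 KmT Kmi wP.
  by rewrite !dotNr !dot_delta lerN2 !mxE => -> ->.
rewrite lee_fin -[X in _ ^+ X]card_ord -prodr_const /box_volume.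
apply: ler_prod => i _; rewrite subr_ge0 ab !mxE /=.
by apply: grad_sub_le_sum_jump => //; [case: (KpP i)|case: (KmP i)].
Qed.
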